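(* Let $\mathbb{X}$ be an override restriction category with override operator $\triangleright$, and let $\diamond$ be its update operator, defined by $f\diamond g=\overline{f}(g\triangleright f)$ for $f,g\in\mathbb{X}(A,B)$. Then for all objects $A,B$ of $\mathbb{X}$, $(\mathbb{X}(A,B),\triangleright,\diamond)$ is an override-update algebra.
   Context: Composition is written diagrammatically: for $f:A\to B$ and $g:B\to C$, $fg:A\to C$ is $f$ followed by $g$. Composition binds more tightly than all other binary operations. A restriction category is a category $\mathbb{X}$ equipped with operations $\overline{(-)}:\mathbb{X}(A,B)\to\mathbb{X}(A,A)$ for all objects $A,B$ such that: [R.1] $\overline{f}f=f$ for $f\in\mathbb{X}(A,B)$; [R.2] $\overline{f}\,\overline{g}=\overline{g}\,\overline{f}$ for $f\in\mathbb{X}(A,B)$, $g\in\mathbb{X}(A,C)$; [R.3] $\overline{\overline{f}g}=\overline{f}\,\overline{g}$ for $f\in\mathbb{X}(A,B)$, $g\in\mathbb{X}(A,C)$; [R.4] $f\overline{g}=\overline{fg}f$ for $f\in\mathbb{X}(A,B)$, $g\in\mathbb{X}(B,C)$. An override restriction category is a restriction category $\mathbb{X}$ with binary operations $\triangleright:\mathbb{X}(A,B)\times\mathbb{X}(A,B)\to\mathbb{X}(A,B)$ for all objects $A,B$ (an override operator) such that: (1) $(f\triangleright g)\triangleright h=f\triangleright(g\triangleright h)$ for $f,g,h\in\mathbb{X}(A,B)$; (2) $f\triangleright\overline{f}g=f$ for $f,g\in\mathbb{X}(A,B)$; (3) $\overline{g}f\triangleright f=f$ for $f\in\mathbb{X}(A,B)$,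 $g\in\mathbb{X}(A,C)$; (4) $f(g\triangleright h)=fg\triangleright fh$ for $f\in\mathbb{X}(A,B)$, $g,h\in\mathbb{X}(B,C)$; (5) $\overline{f\triangleright g}\,h=\overline{f}h\triangleright\overline{g}h$ for $f,g\in\mathbb{X}(A,C)$, $h\in\mathbb{X}(A,B)$. An override-update algebra $(X,\triangleright,\diamond)$ is a set $X$ with binary operations $\triangleright,\diamond:X\times X\to X$ such that for all $x,y,z\in X$: [OU.1] $(x\triangleright y)\triangleright z=x\triangleright(y\triangleright z)$; [OU.2] $x\triangleright x=x$; [OU.3] $x=x\diamond(x\triangleright y)$; [OU.4] $x\triangleright y=(y\diamond x)\triangleright x$; [OU.5] $(x\diamond y)\diamond z=x\diamond(z\triangleright y)$; [OU.6] $x\diamond(y\diamond(x\diamond z))=x\diamond((y\diamond x)\diamond z)$. *)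

(* Defs.v *)
Set Implicit Arguments.
Unset Strict Implicit.
Unset Printing Implicit Defensive.

Declare Scope override_scope.
Delimit Scope override_scope with ovr.
Local Open Scope override_scope.

(* Composition is diagrammatic, and binds more tightly than override:
   [f ;; g] is [f] followed by [g]. *)
Reserved Notation "f ;; g" (at level 40, left associativity).
Reserved Notation "f |> g" (at level 50, left associativity).

Record Category := {
  Ob :> Type;
  Hom : Ob -> Ob -> Type;
  idm : forall A, Hom A A;
  comp : forall A B C, Hom A B -> Hom B C -> Hom A C
    where "f ;; g" := (comp f g);
  comp_idl : forall A B (f : Hom A B), idm A ;; f = f;
  comp_idr : forall A B (f : Hom A B), f ;; idm B = f;
  compA : forall A B C D (f : Hom A B) (g : Hom B C) (h : Hom C D),
    (f ;; g) ;; h = f ;; (g ;; h)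
}.

Arguments Hom {c} A B.
Arguments idm {c} A.
Arguments comp {c A B C} f g.
Notation "f ;; g" := (comp f g) : override_scope.

Record RestrictionCategory := {
  rc_cat :> Category;
  rst : forall A B : rc_cat, Hom A B -> Hom A A;
  rst1 : forall (A B : rc_cat) (f : Hom A B), rst f ;; f = f;
  rst2 : forall (A B C : rc_cat) (f : Hom A B) (g : Hom A C),
    rst f ;; rst g = rst g ;; rst f;
  rst3 : forall (A B C : rc_cat) (f : Hom A B) (g : Hom A C),
    rst (rst f ;; g) = rst f ;; rst g;
  rst4 : forall (A B C : rc_cat) (f : Hom A B) (g : Hom B C),
    f ;; rst g = rst (f ;; g) ;; f
}.

Arguments rst {r A B} f.

Record OverrideRestrictionCategory := {
  orc_rc :> RestrictionCategory;
  override : forall A B : orc_rc, Hom A B -> Hom A B -> Hom A B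
    where "f |> g" := (override f g);
  overrideA : forall (A B : orc_rc) (f g h : Hom A B),
    (f |> g) |> h = f |> (g |> h);
  override_rst_r : forall (A B : orc_rc) (f g : Hom A B),
    f |> rst f ;; g = f;
  override_rst_l : forall (A B C : orc_rc) (f : Hom A B) (g : Hom A C),
    rst g ;; f |> f = f;
  comp_override : forall (A B C : orc_rc) (f : Hom A B) (g h : Hom B C),
    f ;; (g |> h) = f ;; g |> f ;; h;
  rst_override : forall (A B C : orc_rc) (f g : Hom A C) (h : Hom A B),
    rst (f |> g) ;; h = rst f ;; h |> rst g ;; h
}.

Arguments override {o A B} f g.
Notation "f |> g" := (override f g) : override_scope.

Definition update (X : OverrideRestrictionCategory) (A B : X)
    (f g : Hom A B) : Hom A B :=
  rst f ;; (g |> f).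

Arguments update {X A B} f g.

Record OverrideUpdateAlgebra (X : Type) (ov up : X -> X -> X) : Prop := {
  OU1 : forall x y z, ov (ov x y) z = ov x (ov y z);
  OU2 : forall x, ov x x = x;
  OU3 : forall x y, x = up x (ov x y);
  OU4 : forall x y, ov x y = ov (up y x) x;
  OU5 : forall x y z, up (up x y) z = up x (ov z y);
  OU6 : forall x y z, up x (up y (up x z)) = up x (up (up y x) z)
}.

(* Main.v *)
(* The key point is that restriction makes override commutative on domains:
   rst (f |> g) and rst (g |> f) are commuting restriction idempotents that
   absorb each other, hence are equal. It follows that update f g has the
   domain of f, and that f |> g, being defined on rst (g |> f), splits over g
   first, which is [OU.4]; the other axioms expand to equal overrides. *)
Require Import Defs.

Local Open Scope override_scope.

Section OverrideTheory.

Context {X : OverrideRestrictionCategory}.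
Implicit Types A B C : X.

Lemma rst_idem {A B} (f : Hom A B) : rst f ;; rst f = rst f.
Proof. now rewrite <- rst3, rst1. Qed.

Lemma overridexx {A B} (f : Hom A B) : f |> f = f.
Proof. now generalize (override_rst_r f f); rewrite rst1. Qed.

Lemma rst_comp_override_l {A B} (f g : Hom A B) : rst f ;; (f |> g) = f.
Proof. now rewrite comp_override, rst1, override_rst_r. Qed.

Lemma rst_override_absorb_l {A B} (f g : Hom A B) :
  rst (f |> g) ;; rst f = rst f.
Proof. now rewrite rst2, <- rst3, rst_comp_override_l. Qed.

(** Take [h := rst g] in [rst_override]: the second operand becomes [rst g], and the first is a
    restriction of it. *)
Lemma rst_override_absorb_r {A B} (f g : Hom A B) :
  rst (f |> g) ;; rst g = rst g.
Proof. now rewrite rst_override, rst_idem, override_rst_l. Qed.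

Lemma rst_override_absorb {A B} (f g : Hom A B) :
  rst (f |> g) ;; rst (g |> f) = rst (f |> g).
Proof.
rewrite rst_override, (rst2 f), (rst2 g).
rewrite rst_override_absorb_r, rst_override_absorb_l.
(* What remains is [rst_override] with [h] the identity. *)
now rewrite <- (comp_idr (rst f)), <- (comp_idr (rst g)), <- rst_override, comp_idr.
Qed.

Lemma rst_overrideC {A B} (f g : Hom A B) : rst (f |> g) = rst (g |> f).
Proof.
now rewrite <- rst_override_absorb, rst2, rst_override_absorb.
Qed.

Lemma updateE {A B} (f g : Hom A B) : update f g = rst f ;; g |> f.
Proof. now unfold update; rewrite comp_override, rst1. Qed.

Lemma rst_update {A B} (f g : Hom A B) : rst (update f g) = rst f.
Proof. now unfold update; rewrite rst3, rst2, rst_override_absorb_r. Qed.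

Lemma update_override_l {A B} (f g : Hom A B) : update f (f |> g) = f.
Proof. now unfold update; rewrite overrideA, rst_comp_override_l. Qed.

Lemma override_update {A B} (f g : Hom A B) : update g f |> f = f |> g.
Proof.
(* Writing [f] as [rst f ;; (f |> g)] lets [rst_override] collect both operands into
   [rst (g |> f) ;; (f |> g)]. *)
transitivity (rst g ;; (f |> g) |> rst f ;; (f |> g)).
- now rewrite rst_comp_override_l.
- now rewrite <- rst_override, rst_overrideC, rst1.
Qed.

Lemma update_update_l {A B} (f g h : Hom A B) :
  update (update f g) h = update f (h |> g).
Proof.
rewrite (updateE (update f g)), rst_update; unfold update.
now rewrite <- comp_override, overrideA.
Qed.

Lemma update_update_r {A B} (f g h : Hom A B) :
  update f (update g (update f h)) = update f (update (update g f) h).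
Proof.
rewrite update_update_l, !updateE, !comp_override.
(* The two sides differ only by a second [rst f] before [h]. *)
now rewrite <- !compA, (rst2 f g), (compA (rst g) (rst f) (rst f)), rst_idem.
Qed.

End OverrideTheory.

Theorem theorem25 (X : OverrideRestrictionCategory) (A B : X) :
  OverrideUpdateAlgebra (@override X A B) (@update X A B).
Proof.
split.
- apply overrideA.
- apply overridexx.
- intros x y; symmetry; apply update_override_l.
- intros x y; symmetry; apply override_update.
- apply update_update_l.
- apply update_update_r.
Qed.
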